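(* Let $(M,\varphi,\xi,\eta,g)$ be a $3$-dimensional almost contact B-metric manifold and let $C=C(t)$ be a slant null curve on $M$, with $g(\dot C,\xi)=\eta(\dot C)=a$ (a real constant) and $b:=g(\dot C,\varphi\dot C)$ (a smooth function on $C$). If $\mathbf F=\{\dot C,N,W\}$ is a general Frenet frame on $M$ along $C$ which has the same positive orientation as the basis $\{\dot C,\xi,\varphi\dot C\}$ at each $x\in C$, then $$W=\alpha\xi+\beta\dot C+\gamma\varphi\dot C,\qquad N=\lambda\xi+\mu\dot C+\nu\varphi\dot C,$$ where $\beta$ is an arbitrary function and $\alpha,\gamma,\lambda,\mu,\nu$ are the functions $$\alpha=-\frac{b}{\sqrt{a^4+b^2}},\qquad \gamma=\frac{a}{\sqrt{a^4+b^2}},$$ $$\lambda=\frac{a^3+\beta b\sqrt{a^4+b^2}}{a^4+b^2},\qquad \mu=-\frac{a^2+\beta^2(a^4+b^2)}{2(a^4+b^2)},\qquad \nu=\frac{b-\beta a\sqrt{a^4+b^2}}{a^4+b^2}.$$ Moreover, the functions $h$ and $k_1$ with respect to $\mathbf F$ are given by $$h=-\lambda\, g(\dot C,\nabla_{\dot C}\xi)+\frac{\nu}{2}\left[\dot C(b)-F(\dot C,\dot C,\dot C)\right],$$ $$k_1=-\alpha\, g(\dot C,\nabla_{\dot C}\xi)+\frac{\gamma}{2}\left[\dot C(b)-F(\dot C,\dot C,\dot C)\right].$$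
   Context: A $3$-dimensional almost contact B-metric manifold $(M,\varphi,\xi,\eta,g)$ is a $3$-dimensional smooth manifold $M$ with an endomorphism field $\varphi$ of $TM$, a vector field $\xi$ (Reeb vector field), a $1$-form $\eta$ and a pseudo-Riemannian metric $g$ such that $\varphi^2=-\mathrm{id}+\eta\otimes\xi$, $\eta(\xi)=1$ and $g(\varphi X,\varphi Y)=-g(X,Y)+\eta(X)\eta(Y)$. Consequently $\eta\circ\varphi=0$, $\varphi\xi=0$, $\eta(X)=g(X,\xi)$, $g(\xi,\xi)=1$, and $g$ has signature $(2,1)$ (Lorentzian). $\nabla$ is the Levi-Civita connection of $g$, and $F(X,Y,Z)=g((\nabla_X\varphi)Y,Z)$. A null curve is a smooth curve $C(t)$ with $\dot C\ne0$ and $g(\dot C,\dot C)=0$ everywhere. It is slant if $g(\dot C,\xi)=\eta(\dot C)=a$ is a real constant. $\dot C(f)$ denotes the derivative $df/dt$ of a function $f$ along $C$. A general Frenet frame along a null curve $C$ is a frame $\mathbf F=\{\dot C,N,W\}$ of vector fields along $C$ with $g(\dot C,N)=g(W,W)=1$ and $g(N,N)=g(N,W)=g(\dot C,W)=0$. The smooth functions $h,k_1,k_2$ with respect to $\mathbf F$ are those in the general Frenet equations $\nabla_{\dot C}\dot C=h\dot C+k_1W$, $\nabla_{\dot C}N=-hN+k_2W$, $\nabla_{\dot C}W=-k_2\dot C-k_1N$. For every such null curve $\{\dot C,\xi,\varphi\dot C\}$ is a basis of the tangent space $T_xM$ at each $x\in C$. *)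

(* Defs.v *)
From HB Require Import structures.
From mathcomp Require Import all_boot all_order all_algebra.
From mathcomp Require Import all_classical all_reals all_analysis.
Set Implicit Arguments.
Unset Strict Implicit.
Unset Printing Implicit Defensive.
Import Order.TTheory GRing.Theory Num.Theory.
Import numFieldNormedType.Exports.
Local Open Scope classical_set_scope.
Local Open Scope ring_scope.

(* Coordinate vectors are rows: a linear map of matrix A is u |-> u *m A, and
   'd f x u = u *m jacobian f x. *)

(* The domain V is meant to be finite-dimensional: then C^(k+1) means
   differentiable with all directional derivatives of class C^k. *)
Fixpoint Ck (R : realType) (V W : normedModType R) (k : nat) (U : set V)
    (f : V -> W) : Prop :=
  if k is k'.+1
  then (forall x, U x -> differentiable f x) /\
       (forall v, Ck k' U (fun x => 'D_v f x))
  else forall x, U x -> {for x, continuous f}.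

Definition smooth_on (R : realType) (V W : normedModType R) (U : set V)
    (f : V -> W) : Prop := forall k, Ck k U f.

Record smooth_manifold (R : realType) (n : nat) := SmoothManifold {
  points :> topologicalType ;
  chart : Type ;
  dom : chart -> set points ;
  coord : chart -> points -> 'rV[R]_n ;
  param : chart -> 'rV[R]_n -> points ;
  points_hausdorff : hausdorff_space points ;
  points_second_countable : @second_countable points ;
  dom_open : forall c, open (dom c) ;
  dom_cover : forall p, exists c, dom c p ;
  coord_open : forall c, open (coord c @` dom c) ;
  coordK : forall c p, dom c p -> param c (coord c p) = p ;
  coord_continuous : forall c p, dom c p -> {for p, continuous (coord c)} ;
  param_continuous : forall c x, (coord c @` dom c) x ->
    {for x, continuous (param c)} ;
  transition_smooth : forall c d,
    smooth_on (coord c @` (dom c `&` dom d)) (coord d \o param c) }.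

Section Tensors.
Context {R : realType} {n : nat} {M : smooth_manifold R n}.
Implicit Types (c d : chart M) (p : M).

Definition transition_mx c d p : 'M[R]_n :=
  jacobian (coord d \o param c) (coord c p).

Definition smooth_in_chart (W : normedModType R) c (f : M -> W) : Prop :=
  smooth_on (coord c @` dom c) (f \o param c).

(* Derivative at p, in the chart c, along the vector with components u. *)
Definition chart_derive (W : normedModType R) c (f : M -> W) p
    (u : 'rV[R]_n) : W := 'D_u (f \o param c) (coord c p).

(* A tensor field is the family of its component arrays in all the charts,
   related by the transformation law; "T c p" is meaningful for dom c p. *)
Record vector_field := VectorField {
  vf_comp :> chart M -> M -> 'rV[R]_n ;
  vf_law : forall c d p, dom c p -> dom d p ->
    vf_comp d p = vf_comp c p *m transition_mx c d p ;
  vf_smooth : forall c, smooth_in_chart c (vf_comp c) }.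

Record one_form := OneForm {
  form_comp :> chart M -> M -> 'cV[R]_n ;
  form_law : forall c d p, dom c p -> dom d p ->
    form_comp c p = transition_mx c d p *m form_comp d p ;
  form_smooth : forall c, smooth_in_chart c (form_comp c) }.

Record endo_field := EndoField {
  endo_comp :> chart M -> M -> 'M[R]_n ;
  endo_law : forall c d p, dom c p -> dom d p ->
    endo_comp c p *m transition_mx c d p = transition_mx c d p *m endo_comp d p ;
  endo_smooth : forall c, smooth_in_chart c (endo_comp c) }.

Record bilinear_field := BilinearField {
  bil_comp :> chart M -> M -> 'M[R]_n ;
  bil_law : forall c d p, dom c p -> dom d p ->
    bil_comp c p =
      transition_mx c d p *m bil_comp d p *m (transition_mx c d p)^T ;
  bil_smooth : forall c, smooth_in_chart c (bil_comp c) }.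

Definition form_app (e : 'cV[R]_n) (u : 'rV[R]_n) : R := (u *m e) 0 0.

Definition bil_app (G : 'M[R]_n) (u v : 'rV[R]_n) : R := (u *m G *m v^T) 0 0.

(* Affine connections, through the connection matrices in the charts:
   nabla_u Y = D_u Y + Y *m omega(u), that is omega(u)_(j,k) = u^i Gamma^k_(ij).
   The law says that nabla_u Y transforms as a vector. *)
Record connection := Connection {
  conn_mx :> chart M -> M -> {linear 'rV[R]_n -> 'M[R]_n} ;
  conn_law : forall c d p (u : 'rV[R]_n), dom c p -> dom d p ->
    conn_mx c p u *m transition_mx c d p =
      'D_u (jacobian (coord d \o param c)) (coord c p)
      + transition_mx c d p *m conn_mx d p (u *m transition_mx c d p) ;
  conn_smooth : forall c u, smooth_in_chart c (fun p => conn_mx c p u) }.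

Implicit Type D : connection.

Definition nabla_vf D (Y : vector_field) c p (u : 'rV[R]_n) : 'rV[R]_n :=
  chart_derive c (Y c) p u + Y c p *m D c p u.

(* (nabla_u phi) Y = nabla_u (phi Y) - phi (nabla_u Y) *)
Definition nabla_endo D (phi : endo_field) c p (u : 'rV[R]_n) : 'M[R]_n :=
  chart_derive c (phi c) p u + phi c p *m D c p u - D c p u *m phi c p.

(* (nabla_u g)(Y, Z) = u (g(Y, Z)) - g(nabla_u Y, Z) - g(Y, nabla_u Z) *)
Definition nabla_bil D (g : bilinear_field) c p (u : 'rV[R]_n) : 'M[R]_n :=
  chart_derive c (g c) p u - D c p u *m g c p - g c p *m (D c p u)^T.

(* Torsion tensor: nabla_X Y - nabla_Y X - [X, Y] in components. *)
Definition torsion D c p (u v : 'rV[R]_n) : 'rV[R]_n :=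
  v *m D c p u - u *m D c p v.

Definition pseudo_riemannian (g : bilinear_field) : Prop :=
  forall c p, dom c p -> (g c p)^T = g c p /\ g c p \in unitmx.

Definition levi_civita (g : bilinear_field) D : Prop :=
  forall c p, dom c p ->
    (forall u v, torsion D c p u v = 0) /\ (forall u, nabla_bil D g c p u = 0).

Definition almost_contact_B_metric (phi : endo_field) (xi : vector_field)
    (eta : one_form) (g : bilinear_field) : Prop :=
  pseudo_riemannian g /\
  forall c p, dom c p ->
    [/\ forall u, u *m phi c p *m phi c p = - u + form_app (eta c p) u *: xi c p,
        form_app (eta c p) (xi c p) = 1 &
        forall u v, bil_app (g c p) (u *m phi c p) (v *m phi c p) =
          - bil_app (g c p) u v + form_app (eta c p) u * form_app (eta c p) v].

(* F(X, Y, Z) = g((nabla_X phi) Y, Z) *)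
Definition tensor_F (g : bilinear_field) D (phi : endo_field) c p
    (u v w : 'rV[R]_n) : R :=
  bil_app (g c p) (v *m nabla_endo D phi c p u) w.

Definition smooth_curve (I : set R) (C : R -> M) : Prop :=
  [/\ open I, is_interval I, forall t, I t -> {for t, continuous C} &
      forall c, smooth_on (I `&` C @^-1` dom c) (coord c \o C)].

Definition velocity (C : R -> M) c (t : R) : 'rV[R]_n :=
  derive1 (coord c \o C) t.

Definition null_curve (g : bilinear_field) (I : set R) (C : R -> M) : Prop :=
  smooth_curve I C /\
  forall t c, I t -> dom c (C t) ->
    velocity C c t != 0 /\
    bil_app (g c (C t)) (velocity C c t) (velocity C c t) = 0.

Definition slant (xi : vector_field) (eta : one_form) (g : bilinear_field)
    (I : set R) (C : R -> M) (a : R) : Prop :=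
  forall t c, I t -> dom c (C t) ->
    bil_app (g c (C t)) (velocity C c t) (xi c (C t)) = a /\
    form_app (eta c (C t)) (velocity C c t) = a.

Definition field_along (I : set R) (C : R -> M)
    (V : chart M -> R -> 'rV[R]_n) : Prop :=
  (forall t c d, I t -> dom c (C t) -> dom d (C t) ->
     V d t = V c t *m transition_mx c d (C t)) /\
  (forall c, smooth_on (I `&` C @^-1` dom c) (V c)).

Definition nabla_along D (C : R -> M) (V : chart M -> R -> 'rV[R]_n) c (t : R) :
    'rV[R]_n :=
  derive1 (V c) t + V c t *m D c (C t) (velocity C c t).

End Tensors.

Arguments vector_field {R n} M.
Arguments one_form {R n} M.
Arguments endo_field {R n} M.
Arguments bilinear_field {R n} M.
Arguments connection {R n} M.

Definition triple_mx (R : realType) (u v w : 'rV[R]_3) : 'M[R]_3 :=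
  \matrix_(i < 3) nth 0 [:: u; v; w] i.

(* The transition matrix from the basis f to the basis e has det > 0. *)
Definition same_orientation (R : realType) (e f : 'M[R]_3) : Prop :=
  exists2 P : 'M[R]_3, e = P *m f & 0 < \det P.

Section Frenet.
Context {R : realType} {M : smooth_manifold R 3}.
Implicit Types (I : set R) (C : R -> M) (N W : chart M -> R -> 'rV[R]_3).

Definition general_frenet_frame (g : bilinear_field M) I C N W : Prop :=
  [/\ field_along I C N, field_along I C W &
      forall t c, I t -> dom c (C t) ->
        let T := velocity C c t in
        let G := bil_app (g c (C t)) in
        [/\ triple_mx T (N c t) (W c t) \in unitmx,
            G T (N c t) = 1 /\ G (W c t) (W c t) = 1,
            G (N c t) (N c t) = 0, G (N c t) (W c t) = 0 & G T (W c t) = 0]].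

Definition positively_oriented (phi : endo_field M) (xi : vector_field M)
    I C N W : Prop :=
  forall t c, I t -> dom c (C t) ->
    let T := velocity C c t in
    same_orientation (triple_mx T (N c t) (W c t))
                     (triple_mx T (xi c (C t)) (T *m phi c (C t))).

Definition general_frenet_equations (D : connection M) I C N W
    (h k1 k2 : R -> R) : Prop :=
  [/\ smooth_on I h, smooth_on I k1, smooth_on I k2 &
      forall t c, I t -> dom c (C t) ->
        let T := velocity C in
        [/\ nabla_along D C T c t = h t *: T c t + k1 t *: W c t,
            nabla_along D C N c t = - h t *: N c t + k2 t *: W c t &
            nabla_along D C W c t = - k2 t *: T c t - k1 t *: N c t]].

End Frenet.

Section Coefficients.
Context {R : realType}.
Variables (a b beta : R).

Definition coef_alpha : R := - (b / Num.sqrt (a ^+ 4 + b ^+ 2)).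

Definition coef_gamma : R := a / Num.sqrt (a ^+ 4 + b ^+ 2).

Definition coef_lambda : R :=
  (a ^+ 3 + beta * b * Num.sqrt (a ^+ 4 + b ^+ 2)) / (a ^+ 4 + b ^+ 2).

Definition coef_mu : R :=
  - ((a ^+ 2 + beta ^+ 2 * (a ^+ 4 + b ^+ 2)) / (2 * (a ^+ 4 + b ^+ 2))).

Definition coef_nu : R :=
  (b - beta * a * Num.sqrt (a ^+ 4 + b ^+ 2)) / (a ^+ 4 + b ^+ 2).

End Coefficients.

Definition frame_formulas (R : realType) (M : smooth_manifold R 3)
    (phi : endo_field M) (xi : vector_field M) (I : set R) (C : R -> M)
    (a : R) (b beta : R -> R) (N W : chart M -> R -> 'rV[R]_3) : Prop :=
  forall t c, I t -> dom c (C t) ->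
    let T := velocity C c t in
    let phiT := T *m phi c (C t) in
    W c t = coef_alpha a (b t) *: xi c (C t) + beta t *: T
            + coef_gamma a (b t) *: phiT /\
    N c t = coef_lambda a (b t) (beta t) *: xi c (C t)
            + coef_mu a (b t) (beta t) *: T
            + coef_nu a (b t) (beta t) *: phiT.

(* Main.v *)
Require Import Defs.
From HB Require Import structures.
From mathcomp Require Import all_boot all_order all_algebra.
From mathcomp Require Import all_classical all_reals all_analysis.
From mathcomp Require Import ring lra.
Import Order.TTheory GRing.Theory Num.Theory.
Import numFieldNormedType.Exports.
Local Open Scope classical_set_scope.
Local Open Scope ring_scope.
Set Implicit Arguments.
Unset Strict Implicit.
Unset Printing Implicit Defensive.

(** Write T for the velocity of C, S = a^4 + b^2 and s = sqrt S.

    The argument is linear algebra in the Gram matrix of the triple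
    (xi, T, phi T), whose entries are 1, a, 0, 0, b and a^2, with determinant
    - S. The identities of an almost contact B-metric structure make the triple
    free ([adapted_unit]), and if S vanished then T would be orthogonal to a
    basis, against the nondegeneracy of g ([adapted_disc_gt0]). So every frame
    vector is x xi + y T + z phi T, and the frame conditions become polynomial
    equations in the six coefficients. From g(T,W) = 0 the pair (alpha, gamma)
    is k (-b, a); since g(T,N) = 1, that number k is the determinant of the
    transition matrix from (T, xi, phi T) to (T, N, W). Then g(W,W) = 1 says
    k^2 S = 1 and the orientation selects k = 1/s, after which g(N,W) = 0,
    g(T,N) = 1 and g(N,N) = 0 determine lambda, nu and mu in terms of beta
    ([frame_coefs_unique]); conversely the resulting coefficients satisfy all
    the equations ([frame_coefsP]).

    For the curvatures, g(nabla_T T, N) = h and g(nabla_T T, W) = k_1 by the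
    first Frenet equation, so it is enough to know the products of nabla_T T with
    T, xi and phi T. They come from differentiating the three functions
    g(T,T) = 0, g(T,xi) = a and g(T,phi T) = b along C with nabla g = 0
    ([velocity_projections]); in the last one the symmetry of phi with respect
    to g makes g(nabla_T T, phi T) appear twice, hence the factor 1/2.

    The rest is regularity and independence of the chart. The function beta is
    recovered from W as (a^3 g(W,xi) + b g(W,phi T)) / S, an expression that is
    the same in all charts and smooth; conversely N and W built from a smooth
    beta obey the transformation law of vectors and are smooth. Both directions
    rest on a calculus of [Ck] functions: products, quotients, square roots and
    composition. *)

(** * Calculus of C^k functions *)

Section CkCalculus.
Context {R : realType} {V : normedModType R}.

(** The difference of two functions that agree near x is differentiable at x,
    with null differential. *)
Lemma near_eq_differentiable (W : normedModType R) (f h : V -> W) x :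
  (\forall y \near x, f y = h y) -> differentiable f x -> differentiable h x.
Proof.
move=> fh df; suff de : differentiable (h - f) x.
  by rewrite -[h](subrK f); exact: differentiableD.
have e0 : (h - f) \o shift x =
    cst ((h - f) x) + (\0 : {linear V -> W}) +o_ (0 : V) id.
  apply/eqaddoP => _/posnumP[e]; near=> y.
  rewrite /= !fctE (nbhs_singleton fh) subrr add0r subr0.
  rewrite -(_ : f (y + x) = h (y + x)) ?subrr ?normr0 ?mulr_ge0//.
  near: y; have := fh; rewrite (near_shift 0 x).
  by apply: filterS => y; rewrite /= subr0.
have c0 : continuous (\0 : {linear V -> W}) by move=> y; exact: cst_continuous.
by apply/diff_locallyP; rewrite (diff_unique c0 e0).
Unshelve. all: by end_near. Qed.
Implicit Types (W : normedModType R) (U : set V) (k : nat).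

Lemma Ck_sub W k U1 U2 (f : V -> W) : U1 `<=` U2 -> Ck k U2 f -> Ck k U1 f.
Proof.
move=> U12; elim: k f => [|k IHk] f /=; first by move=> cf x /U12 /cf.
by move=> [df Df]; split=> [x /U12 /df //|v]; apply: IHk.
Qed.

(** Regularity is a pointwise condition at each order, so it can be tested near
    each point separately; charts are glued along a curve in this way. *)
Lemma Ck_local W k U (f : V -> W) :
  (forall x, U x -> exists2 U', U' x & Ck k U' f) -> Ck k U f.
Proof.
elim: k f => [|k IHk] f /= loc; first by move=> x /loc[U' U'x]; apply.
split=> [x /loc[U' U'x [df _]]|v]; first exact: df.
by apply: IHk => x /loc[U' U'x [_ Df]]; exists U'.
Qed.

Lemma CkW W k U (f : V -> W) : Ck k.+1 U f -> Ck k U f.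
Proof.
elim: k f => [|k IHk] f [df Df]; last by split=> // v; apply/IHk/Df.
by move=> x Ux; exact/differentiable_continuous/df.
Qed.

(** On an open set the derivatives of all orders depend only on the values of
    the function there, whatever it does outside. *)
Lemma Ck_eq_on W k U (f h : V -> W) : open U -> (forall x, U x -> f x = h x) ->
  Ck k U f -> Ck k U h.
Proof.
move=> oU; have fhN (f' h' : V -> W) x : (forall y, U y -> f' y = h' y) ->
    U x -> \forall y \near x, f' y = h' y.
  by move=> fh Ux; apply: filterS (open_nbhs_nbhs (conj oU Ux)) => y; exact: fh.
elim: k f h => [|k IHk] f h fh.
  move=> cf x Ux.
  change (h @ x --> h x); rewrite -(fh x Ux); apply: cvg_trans (cf x Ux).
  exact/near_eq_cvg/fhN.
move=> [df Df]; split=> [x Ux|v].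
  exact: near_eq_differentiable (fhN _ _ _ fh Ux) (df _ Ux).
by apply: IHk (Df v) => x Ux; apply/near_eq_derive/fhN.
Qed.

Lemma Ck_cst W k U (w : W) : Ck k U (fun=> w).
Proof.
elim: k w => [|k IHk] w /=; first by move=> x _; exact: cst_continuous.
split=> [x _|v]; first exact: differentiable_cst.
suff -> : 'D_v (fun=> w) = (fun=> 0) :> (V -> W) by exact: IHk.
by apply/funext => x; exact: derive_cst.
Qed.

Lemma CkD W k U (f h : V -> W) : open U -> Ck k U f -> Ck k U h ->
  Ck k U (fun x => f x + h x).
Proof.
move=> oU; elim: k f h => [|k IHk] f h /=.
  by move=> cf ch x Ux; apply: continuousD; [exact: cf|exact: ch].
move=> [df Df] [dh Dh]; split=> [x Ux|v].
  by apply: differentiableD; [exact: df|exact: dh].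
apply: Ck_eq_on (IHk _ _ (Df v) (Dh v)) => // x Ux.
by rewrite -deriveD//; apply: diff_derivable; [exact: df|exact: dh].
Qed.

Lemma Ck_sum W k U n (f : 'I_n -> V -> W) : open U ->
  (forall i, Ck k U (f i)) -> Ck k U (fun x => \sum_i f i x).
Proof.
move=> oU Hf; elim: n f Hf => [|n IHn] f Hf.
  by apply: Ck_eq_on (Ck_cst _ _ 0) => // x _; rewrite big_ord0.
apply: Ck_eq_on (CkD oU (IHn (fun i => f (widen_ord (leqnSn n) i)) _)
  (Hf ord_max)) => // x _.
by rewrite big_ord_recr.
Qed.

Lemma derive_lin {W1 W2 : normedModType R} (L : {linear W1 -> W2})
    (f : V -> W1) x v :
  continuous L -> differentiable f x ->
  differentiable (L \o f) x /\ 'D_v (L \o f) x = L ('D_v f x).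
Proof.
move=> cL df; have dL := linear_differentiable (f x) cL.
have dc := differentiable_comp df dL.
by split=> //; rewrite !deriveE// diff_comp//= diff_lin.
Qed.

Lemma Ck_lin {W1 W2 : normedModType R} (L : {linear W1 -> W2}) k U
    (f : V -> W1) : continuous L -> open U -> Ck k U f ->
  Ck k U (fun x => L (f x)).
Proof.
move=> cL oU; elim: k f => [|k IHk] f /=.
  by move=> cf x Ux; apply: continuous_comp; [exact: cf|exact: cL].
move=> [df Df]; split=> [x Ux|v].
  by have [] := derive_lin 0 cL (df x Ux).
apply: Ck_eq_on (IHk _ (Df v)) => // x Ux.
by have [_ <-] := derive_lin v cL (df x Ux).
Qed.

Lemma derive_bilin {W1 W2 W3 : normedModType R} (B : {bilinear W1 -> W2 -> W3})
    (f : V -> W1) (h : V -> W2) x v :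
  continuous (fun p => B p.1 p.2) -> differentiable f x -> differentiable h x ->
  differentiable (fun y => B (f y) (h y)) x /\
  'D_v (fun y => B (f y) (h y)) x = B ('D_v f x) (h x) + B (f x) ('D_v h x).
Proof.
move=> cB df dh; have dB := differentiable_bilin (f x, h x) cB.
have dp := differentiable_pair df dh.
have dc := differentiable_comp dp dB; split=> //.
rewrite !deriveE// (diff_comp dp dB)/= diff_bilin//= diff_pair//=.
by rewrite addrC.
Qed.

(** Every product used later (of scalars, of matrices, of a scalar and a
    vector) is a continuous bilinear map, so that one induction through the
    Leibniz rule serves them all. *)
Lemma Ck_bilin {W1 W2 W3 : normedModType R} (B : {bilinear W1 -> W2 -> W3}) k U
    (f : V -> W1) (h : V -> W2) :
  continuous (fun p => B p.1 p.2) -> open U -> Ck k U f -> Ck k U h ->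
  Ck k U (fun x => B (f x) (h x)).
Proof.
move=> cB oU; elim: k f h => [|k IHk] f h.
  move=> cf ch x Ux.
  apply: (@continuous_comp _ _ _ (fun y => (f y, h y)) (fun p => B p.1 p.2)).
    by apply: cvg_pair; [exact: cf|exact: ch].
  exact: cB.
move=> Hf Hh; have [df Df] := Hf; have [dh Dh] := Hh.
split=> [x Ux|v].
  by have [] := derive_bilin 0 cB (df x Ux) (dh x Ux).
apply: (@Ck_eq_on _ _ _
  (fun x => B ('D_v f x) (h x) + B (f x) ('D_v h x))) => //.
  by move=> x Ux; have [_ <-] := derive_bilin v cB (df x Ux) (dh x Ux).
by apply: (CkD oU); apply: IHk; [exact: Df|exact: CkW|exact: CkW|exact: Dh].
Qed.

End CkCalculus.

Lemma mx_cvgP {R : realType} (T : Type) (F : set_system T) {FF : Filter F} m n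
    (f : T -> 'M[R]_(m, n)) (l : 'M[R]_(m, n)) :
  (forall i j, (fun x => f x i j) @ F --> l i j) -> f @ F --> l.
Proof.
move=> fl; apply/cvgrPdist_le => /= e e0; near=> x.
rewrite /Num.Def.normr/= mx_normrE (bigmax_le _ (ltW e0))//= => i _.
rewrite !mxE/=; move: i; near: x; apply: filter_forall => /= i.
exact: (cvgrPdist_le _ _).1 (fl i.1 i.2) e e0.
Unshelve. all: by end_near. Qed.

Lemma mulmx_continuous {R : realType} m n p :
  continuous (fun q : 'M[R]_(m, n) * 'M[R]_(n, p) => q.1 *m q.2).
Proof.
move=> q; apply: mx_cvgP => i j.
rewrite mxE; under eq_fun do rewrite mxE.
apply: (@cvg_big _ _ _ _ _ add_continuous) => k _; apply: cvgM.
  apply: (@continuous_comp _ _ _ fst (fun M : 'M[R]_(m, n) => M i k)).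
    exact: cvg_fst.
  exact: coord_continuous.
apply: (@continuous_comp _ _ _ snd (fun M : 'M[R]_(n, p) => M k j)).
  exact: cvg_snd.
exact: coord_continuous.
Qed.

Lemma trmx_continuous {R : realType} m n :
  continuous (fun A : 'M[R]_(m, n) => A^T).
Proof.
move=> A; apply: (@mx_cvgP _ _ (nbhs A)) => i j; rewrite mxE.
under eq_fun do rewrite mxE.
exact: coord_continuous.
Qed.

Lemma scale_is_bilinear (R : realType) (W : normedModType R) :
  bilinear_for
    (GRing.Scale.Law.clone _ _ *:%R _) (GRing.Scale.Law.clone _ _ *:%R _)
    (@GRing.scale R W : R -> W -> W).
Proof.
split=> [w|u] a x y /=; first by rewrite scalerDl scalerA.
by rewrite scalerDr !scalerA mulrC.
Qed.

HB.instance Definition _ (R : realType) (W : normedModType R) :=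
  bilinear_isBilinear.Build R R W W _ _ (@GRing.scale R W)
  (@scale_is_bilinear R W).

Section CkProducts.
Context {R : realType} {V : normedModType R}.
Implicit Types (U : set V) (k : nat).

Lemma Ck_mulmx m n p k U (f : V -> 'M[R]_(m, n)) (h : V -> 'M[R]_(n, p)) :
  open U -> Ck k U f -> Ck k U h -> Ck k U (fun x => f x *m h x).
Proof. exact/Ck_bilin/mulmx_continuous. Qed.

Lemma Ck_scale (W : normedModType R) k U (f : V -> R) (h : V -> W) :
  open U -> Ck k U f -> Ck k U h -> Ck k U (fun x => f x *: h x).
Proof. exact/Ck_bilin/scale_continuous. Qed.

Lemma CkM k U (f h : V -> R) :
  open U -> Ck k U f -> Ck k U h -> Ck k U (fun x => f x * h x).
Proof. apply/Ck_bilin/mul_continuous. Qed.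

Lemma CkN k U (f : V -> R) : open U -> Ck k U f -> Ck k U (fun x => - f x).
Proof.
move=> oU Hf; apply: Ck_eq_on oU _ (CkM oU (Ck_cst k U (- 1 : R)) Hf) => x _.
by rewrite mulN1r.
Qed.

Lemma Ck_trmx m n k U (f : V -> 'M[R]_(m, n)) :
  open U -> Ck k U f -> Ck k U (fun x => (f x)^T).
Proof. exact/Ck_lin/trmx_continuous. Qed.

Lemma derive_mulmx m n p (f : V -> 'M[R]_(m, n)) (h : V -> 'M[R]_(n, p)) x v :
  differentiable f x -> differentiable h x ->
  differentiable (fun y => f y *m h y) x /\
  'D_v (fun y => f y *m h y) x = 'D_v f x *m h x + f x *m 'D_v h x.
Proof. exact/derive_bilin/mulmx_continuous. Qed.

Lemma derive_trmx m n (f : V -> 'M[R]_(m, n)) x v : differentiable f x ->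
  differentiable (fun y => (f y)^T) x /\
  'D_v (fun y => (f y)^T) x = ('D_v f x)^T.
Proof. exact/derive_lin/trmx_continuous. Qed.

Lemma Ck_coord m n k U (f : V -> 'M[R]_(m, n)) i j :
  open U -> Ck k U f -> Ck k U (fun x => f x i j).
Proof.
move=> oU Hf; pose L : 'M[R]_(m, n) -> R := fun M => M i j.
have linL : linear L by move=> a u v; rewrite /L !mxE.
pose LM := GRing.isLinear.Build _ _ _ _ L linL.
pose LL : {linear 'M[R]_(m, n) -> R} := HB.pack L LM.
apply: (@Ck_lin _ _ _ _ LL) => //; exact: coord_continuous.
Qed.

Lemma derive_comp (W1 W2 : normedModType R) (f : W1 -> W2) (q : V -> W1) x v :
  differentiable q x -> differentiable f (q x) ->
  'D_v (f \o q) x = 'D_('D_v q x) f (q x).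
Proof.
move=> dq df; rewrite (deriveE _ (differentiable_comp dq df)) diff_comp//=.
by rewrite -!deriveE.
Qed.

Lemma derive_comp_rV (W : normedModType R) n (f : 'rV[R]_n -> W)
    (q : V -> 'rV[R]_n) x v :
  differentiable q x -> differentiable f (q x) ->
  'D_v (f \o q) x = \sum_i ('D_v q x) 0 i *: 'D_(delta_mx 0 i) f (q x).
Proof.
move=> dq df; rewrite derive_comp// deriveE// [in LHS](row_sum_delta ('D_v q x)).
by rewrite linear_sum/=; apply: eq_bigr => i _; rewrite linearZ/= -deriveE.
Qed.

(** In finite dimension the chain rule gives a finite sum of products of
    components of 'D_v q and of partial derivatives of f composed with q: these
    are one order less regular, which closes the induction. *)
Lemma Ck_comp (W : normedModType R) n k U (A : set 'rV[R]_n) (f : 'rV[R]_n -> W)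
    (q : V -> 'rV[R]_n) :
  open U -> (forall x, U x -> A (q x)) ->
  Ck k A f -> Ck k U q -> Ck k U (f \o q).
Proof.
move=> oU UA; elim: k f => [|k IHk] f.
  by move=> cf cq x Ux; apply: continuous_comp; [exact: cq|exact/cf/UA].
move=> [df Df] Hq; have [dq Dq] := Hq; split=> [x Ux|v].
  by apply: differentiable_comp; [exact: dq|exact/df/UA].
apply: (@Ck_eq_on _ _ _ _ _ (fun x =>
  \sum_i ('D_v q x) 0 i *: 'D_(delta_mx 0 i) f (q x))) => //.
  by move=> x Ux; rewrite derive_comp_rV//; [exact: dq|exact/df/UA].
apply: Ck_sum => // i; apply: Ck_scale => //.
  by apply: Ck_coord => //; exact: Dq.
exact: (IHk ('D_(delta_mx 0 i) f) (Df _) (CkW Hq)).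
Qed.

Lemma Ck_inv k U (f : V -> R) : open U -> (forall x, U x -> f x != 0) ->
  Ck k U f -> Ck k U (fun x => (f x)^-1).
Proof.
move=> oU f0; elim: k => [|k IHk].
  by move=> cf x Ux; apply: continuousV; [exact: f0|exact: cf].
move=> Hf; have [df Df] := Hf; split=> [x Ux|v].
  by apply: differentiableV; [exact: df|exact: f0].
apply: (@Ck_eq_on _ _ _ _ _ (fun x =>
  (- 1) * ((f x)^-1 * (f x)^-1) * 'D_v f x)) => //.
  move=> x Ux; have [dfx fx0] := (df x Ux, f0 x Ux).
  rewrite (deriveE _ dfx) (deriveE _ (differentiableV dfx fx0)) diffV//=.
  by rewrite mulN1r expr2 invfM.
have If := IHk (CkW Hf).
exact: (CkM oU (CkM oU (Ck_cst _ _ (- 1 : R)) (CkM oU If If)) (Df v)).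
Qed.

Lemma Ck_sqrt k U (f : V -> R) : open U -> (forall x, U x -> 0 < f x) ->
  Ck k U f -> Ck k U (fun x => Num.sqrt (f x)).
Proof.
move=> oU f0; elim: k => [|k IHk].
  move=> cf x Ux.
  by apply: (@continuous_comp _ _ _ f); [exact: cf|exact: sqrt_continuous].
have ds x : U x -> differentiable (Num.sqrt : R -> R) (f x).
  by move=> Ux; apply/derivable1_diffP; have [] := is_derive1_sqrt (f0 x Ux).
move=> Hf; have [df Df] := Hf; split=> [x Ux|v].
  by apply: (@differentiable_comp _ _ _ _ f); [exact: df|exact: ds].
apply: (@Ck_eq_on _ _ _ _ _ (fun x =>
  (2 * Num.sqrt (f x))^-1 * 'D_v f x)) => //.
  move=> x Ux; rewrite [RHS]deriveE; last first.
    by apply: (@differentiable_comp _ _ _ _ f); [exact: df|exact: ds].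
  rewrite (diff_comp (df x Ux) (ds x Ux))/= -(deriveE _ (df x Ux)).
  rewrite diff1E; last exact: ds.
  by rewrite derive1E derive_sqrt ?f0// mulrC.
have S2 := CkM oU (Ck_cst k U (2 : R)) (IHk (CkW Hf)).
apply: CkM oU (Ck_inv oU _ S2) (Df v) => x Ux.
by rewrite mulf_neq0// gt_eqF// sqrtr_gt0 f0.
Qed.

End CkProducts.

(** * The coefficients of a frame *)

Section Bilinear.
Context {R : realType} {n : nat}.
Implicit Types (G : 'M[R]_n) (u v w : 'rV[R]_n) (x : R).

Lemma bilDl G u v w : bil_app G (u + v) w = bil_app G u w + bil_app G v w.
Proof. by rewrite /bil_app !mulmxDl mxE. Qed.

Lemma bilDr G u v w : bil_app G u (v + w) = bil_app G u v + bil_app G u w.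
Proof. by rewrite /bil_app linearD/= mulmxDr mxE. Qed.

Lemma bilZl G x u v : bil_app G (x *: u) v = x * bil_app G u v.
Proof. by rewrite /bil_app -!scalemxAl mxE. Qed.

Lemma bilZr G x u v : bil_app G u (x *: v) = x * bil_app G u v.
Proof. by rewrite /bil_app linearZ/= -scalemxAr mxE. Qed.

Definition bilE := (bilDl, bilDr, bilZl, bilZr).

Lemma bilC G u v : G^T = G -> bil_app G u v = bil_app G v u.
Proof.
move=> symG; rewrite /bil_app -[in LHS](trmxK (u *m G *m v^T)) [LHS]mxE.
by rewrite !trmx_mul trmxK symG mulmxA.
Qed.

End Bilinear.

Lemma ord3 (i : 'I_3) : [\/ i = 0, i = 1 | i = 2].
Proof.
by case: i => -[|[|[|//]]] ?; [apply: Or31|apply: Or32|apply: Or33];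
  exact: val_inj.
Qed.

Section Triples.
Context {R : realType}.
Implicit Types (u v w : 'rV[R]_3) (P : 'M[R]_3).

Lemma mul_triple_mx P u v w : P *m triple_mx u v w =
  triple_mx (P 0 0 *: u + P 0 1 *: v + P 0 2 *: w)
            (P 1 0 *: u + P 1 1 *: v + P 1 2 *: w)
            (P 2 0 *: u + P 2 1 *: v + P 2 2 *: w).
Proof.
have e1 : lift ord0 ord0 = 1 :> 'I_3 by exact: val_inj.
have e2 : lift ord0 (lift ord0 ord0) = 2 :> 'I_3 by exact: val_inj.
apply/row_matrixP => i; rewrite row_mul mulmx_sum_row !big_ord_recl big_ord0.
rewrite !rowK addr0 addrA !mxE /= e1 e2.
by case: (ord3 i) => ->.
Qed.

Lemma triple_mx_inj u v w u' v' w' :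
  triple_mx u v w = triple_mx u' v' w' -> [/\ u = u', v = v' & w = w'].
Proof.
by move=> e; split; [have := congr1 (row 0) e|have := congr1 (row 1) e|
  have := congr1 (row 2) e]; rewrite !rowK.
Qed.

Lemma det_mx33 P : \det P =
  P 0 0 * (P 1 1 * P 2 2 - P 1 2 * P 2 1)
  - P 0 1 * (P 1 0 * P 2 2 - P 1 2 * P 2 0)
  + P 0 2 * (P 1 0 * P 2 1 - P 1 1 * P 2 0).
Proof.
rewrite (expand_det_row _ 0) !big_ord_recl big_ord0 /cofactor.
rewrite !(expand_det_row _ 0) !big_ord_recl !big_ord0 /cofactor !det_mx11 !mxE.
pose p i j := P (inord i) (inord j).
have pE i j : P i j = p i j by rewrite /p !inord_val.
rewrite !pE /= /bump /=. ring.
Qed.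

End Triples.

Section FrameCoefficients.
Context {R : realType}.
Variables (a b : R).
Hypothesis S_gt0 : 0 < a ^+ 4 + b ^+ 2.

Let S := a ^+ 4 + b ^+ 2.
Let s := Num.sqrt S.

Let s_gt0 : 0 < s. Proof. by rewrite sqrtr_gt0. Qed.
Let sqr_s : s ^+ 2 = S. Proof. by rewrite sqr_sqrtr// ltW. Qed.

Let s_neq0 : s != 0. Proof. by rewrite gt_eqF. Qed.
Let S_neq0 : S != 0. Proof. by rewrite gt_eqF. Qed.

(** The left-hand side is g(N,N) - 2 mu g(T,N) for the vector N with
    coefficients lambda, mu, nu, which is how mu is found. *)
Lemma coef_lambda_nu_norm be :
  coef_lambda a b be ^+ 2 + coef_nu a b be ^+ 2 * a ^+ 2 =
  - (2 * coef_mu a b be).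
Proof.
rewrite /coef_mu /coef_lambda /coef_nu -/S -/s.
have -> : a ^+ 2 + be ^+ 2 * S =
    ((a ^+ 3 + be * b * s) ^+ 2 + (b - be * a * s) ^+ 2 * a ^+ 2) / S.
  apply: (canRL (mulfK S_neq0)); transitivity ((a ^+ 2 + be ^+ 2 * s ^+ 2) * S).
    by rewrite sqr_s.
  by rewrite /S; ring.
by field; rewrite S_neq0.
Qed.

(** The equations are g(T,N) = 1, g(T,W) = 0, g(W,W) = 1, g(N,N) = 0 and
    g(N,W) = 0 in coordinates, and the inequality is the orientation. The
    determinant k = la * ga - nu * al satisfies (al, ga) = k (-b, a) and
    k s = 1; the system is then linear in la and nu. *)
Lemma frame_coefs_unique al be ga la mu nu :
  la * a + nu * b = 1 -> al * a + ga * b = 0 ->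
  al ^+ 2 + ga ^+ 2 * a ^+ 2 + 2 * be * (al * a + ga * b) = 1 ->
  la ^+ 2 + nu ^+ 2 * a ^+ 2 + 2 * mu * (la * a + nu * b) = 0 ->
  la * al + nu * ga * a ^+ 2 + be * (la * a + nu * b)
    + mu * (al * a + ga * b) = 0 ->
  0 < la * ga - nu * al ->
  [/\ al = coef_alpha a b, ga = coef_gamma a b, la = coef_lambda a b be,
      mu = coef_mu a b be & nu = coef_nu a b be].
Proof.
move=> TN TW; rewrite TW TN mulr0 addr0 !mulr1 => WW NN.
rewrite mulr0 addr0 => NW.
set k := la * ga - nu * al => k_gt0.
have gaE : ga = a * k.
  by rewrite -[LHS]mulr1 -TN /k; move: TW => /(congr1 ( *%R nu)); lra.
have alE : al = - (b * k).
  by rewrite -[LHS]mulr1 -TN /k; move: TW => /(congr1 ( *%R la)); lra.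
have kS : k ^+ 2 * S = 1 by rewrite -WW gaE alE /S; ring.
have ks : k * s = 1.
  by apply/eqP; rewrite -(@eqrXn2 _ 2) ?mulr_ge0 ?ltW// exprMn sqr_s kS expr1n.
have kE : k = s^-1 by apply: (mulIf s_neq0); rewrite ks mulVf.
have NW' : a ^+ 3 * nu - b * la = - be * s.
  rewrite -[LHS]mulr1 -ks; transitivity ((la * al + nu * ga * a ^+ 2) * s).
    by rewrite gaE alE; ring.
  by rewrite (_ : _ + _ = - be); [|lra].
have laE : la = coef_lambda a b be.
  rewrite /coef_lambda -/S -/s; apply: (canRL (mulfK S_neq0)); rewrite /S.
  move: (congr1 ( *%R (a ^+ 3)) TN) (congr1 ( *%R b) NW'); lra.
have nuE : nu = coef_nu a b be.
  rewrite /coef_nu -/S -/s; apply: (canRL (mulfK S_neq0)); rewrite /S.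
  move: (congr1 ( *%R b) TN) (congr1 ( *%R a) NW'); lra.
split=> //.
- by rewrite alE kE.
- by rewrite gaE kE.
by have := coef_lambda_nu_norm be; rewrite -laE -nuE; lra.
Qed.

Lemma frame_coefsP be (al := coef_alpha a b) (ga := coef_gamma a b)
    (la := coef_lambda a b be) (mu := coef_mu a b be) (nu := coef_nu a b be) :
  [/\ la * a + nu * b = 1, al * a + ga * b = 0,
      al ^+ 2 + ga ^+ 2 * a ^+ 2 = 1,
      la ^+ 2 + nu ^+ 2 * a ^+ 2 + 2 * mu = 0 &
      la * al + nu * ga * a ^+ 2 + be = 0] /\
  0 < la * ga - nu * al.
Proof.
have TN : la * a + nu * b = 1.
  by rewrite /la /nu /coef_lambda /coef_nu -/S -/s -[RHS](mulfV S_neq0) /S; ring.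
split; first split=> //.
- by rewrite /al /ga /coef_alpha /coef_gamma -/S -/s; ring.
- rewrite /al /ga /coef_alpha /coef_gamma -/S -/s.
  by rewrite -[RHS](mulfV S_neq0) -{2}sqr_s /S; field.
- by rewrite coef_lambda_nu_norm addNr.
- rewrite /la /nu /al /ga /coef_lambda /coef_nu /coef_alpha /coef_gamma -/S -/s.
  apply/eqP; rewrite addr_eq0; apply/eqP.
  transitivity (- (be * ((a ^+ 4 + b ^+ 2) / S) * (s / s))); first by ring.
  by rewrite !mulfV// !mulr1.
suff -> : la * ga - nu * al = s^-1 by rewrite invr_gt0.
rewrite -[RHS]mul1r -TN /al /ga /coef_alpha /coef_gamma -/S -/s; ring.
Qed.

End FrameCoefficients.

(** * Almost contact B-metric structures at a point *)

Section PointwiseAlgebra.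
Context {R : realType} {G phi : 'M[R]_3} {xi : 'rV[R]_3} {eta : 'cV[R]_3}.
Hypothesis symG : G^T = G.
Hypothesis unitG : G \in unitmx.
Hypothesis phi2 : forall u, u *m phi *m phi = - u + form_app eta u *: xi.
Hypothesis eta_xi : form_app eta xi = 1.
Hypothesis Gphi : forall u v, bil_app G (u *m phi) (v *m phi) =
  - bil_app G u v + form_app eta u * form_app eta v.

Lemma xi_neq0 : xi != 0.
Proof.
apply: contra_eq_neq eta_xi => ->.
by rewrite /form_app mul0mx mxE eq_sym oner_eq0.
Qed.

(** phi xi is a multiple x xi of xi, because phi^2 (phi xi) = phi (phi^2 xi)
    = 0; then phi^2 xi = x^2 xi = 0 forces x = 0. *)
Lemma phi_xi : xi *m phi = 0.
Proof.
have phi2xi : xi *m phi *m phi = 0 by rewrite phi2 eta_xi scale1r addNr.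
have := phi2 (xi *m phi); rewrite phi2xi mul0mx; move: (form_app _ _) => x.
move=> /esym/eqP; rewrite addrC subr_eq0 => /eqP pxi.
have := phi2xi; rewrite -pxi -scalemxAl -pxi scalerA.
move=> /eqP; rewrite scaler_eq0 (negPf xi_neq0) orbF mulf_eq0 orbb.
by move=> /eqP ->; rewrite scale0r.
Qed.

Lemma eta_phi u : form_app eta (u *m phi) = 0.
Proof.
have := phi2 (u *m phi); rewrite (phi2 u) mulmxDl mulNmx -scalemxAl phi_xi scaler0.
move=> /addrI/esym/eqP; rewrite scaler_eq0 (negPf xi_neq0) orbF.
by move=> /eqP.
Qed.

Lemma bil_xi u : bil_app G u xi = form_app eta u.
Proof.
have := Gphi u xi; rewrite phi_xi eta_xi mulr1 /bil_app trmx0 mulmx0 mxE.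
by move=> /esym/eqP; rewrite addrC subr_eq0 => /eqP.
Qed.

Lemma bil_phi u v : bil_app G (u *m phi) v = bil_app G u (v *m phi).
Proof.
have := Gphi u (v *m phi); rewrite eta_phi mulr0 addr0 phi2 bilDr bilZr.
rewrite bil_xi eta_phi mulr0 addr0 -scaleN1r bilZr !mulN1r => /oppr_inj.
by [].
Qed.

Section NullVector.
Variables (T : 'rV[R]_3) (a b : R).
Hypothesis T_neq0 : T != 0.
Hypothesis TT : bil_app G T T = 0.
Hypothesis Txi : bil_app G T xi = a.
Hypothesis TphiT : bil_app G T (T *m phi) = b.
Let phiT := T *m phi.
Let F := triple_mx T xi phiT.

Let eta_T : form_app eta T = a. Proof. by rewrite -bil_xi. Qed.

Lemma adapted_gram :
  [/\ bil_app G xi T = a, bil_app G xi xi = 1, bil_app G xi phiT = 0 &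
  [/\ bil_app G phiT T = b, bil_app G phiT xi = 0 &
      bil_app G phiT phiT = a ^+ 2]].
Proof.
rewrite !(bilC xi) // !(bilC phiT T)//; split=> //.
- by rewrite bil_xi.
- by rewrite bil_xi eta_phi.
split=> //; first by rewrite bil_xi eta_phi.
by rewrite Gphi TT oppr0 add0r eta_T expr2.
Qed.

(** Applying phi twice to the relation, and eliminating T and xi, leaves
    (x^2 + z^2) phi T = 0; phi T = 0 would make T a null multiple of xi, which
    has norm 1. *)
Lemma adapted_free x y z : x *: T + y *: xi + z *: phiT = 0 ->
  [/\ x = 0, y = 0 & z = 0].
Proof.
move=> e0; have phiT_neq0 : phiT != 0.
  apply: contra_neq T_neq0 => phiT0; have := phi2 T.
  rewrite -/phiT phiT0 mul0mx eta_T => /esym/eqP; rewrite addrC subr_eq0.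
  move=> /eqP TE; have := TT; rewrite -TE bilZl bilZr bil_xi eta_xi mulr1.
  by move=> /eqP; rewrite mulf_eq0 orbb => /eqP ->; rewrite scale0r.
have e1 : x *: phiT + z *: (- T + a *: xi) = 0.
  have := congr1 (mulmxr phi) e0; rewrite /= !mulmxDl -!scalemxAl phi_xi.
  by rewrite mul0mx phi2 eta_T scaler0 addr0.
have e2 : x *: (- T + a *: xi) - z *: phiT = 0.
  have := congr1 (mulmxr phi) e1; rewrite /= mulmxDl -!scalemxAl mulmxDl mulNmx.
  by rewrite -scalemxAl phi_xi mul0mx phi2 eta_T scaler0 addr0 scalerN.
have : (x ^+ 2 + z ^+ 2) *: phiT = 0.
  transitivity (x *: (x *: phiT + z *: (- T + a *: xi)) -
    z *: (x *: (- T + a *: xi) - z *: phiT)); last first.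
    by rewrite e1 e2 !scaler0 subr0.
  apply/rowP => i; rewrite !mxE; ring.
move=> /eqP; rewrite scaler_eq0 (negPf phiT_neq0) orbF.
rewrite paddr_eq0 ?sqr_ge0// !sqrf_eq0 => /andP[/eqP x0 /eqP z0].
move: e0; rewrite x0 z0 !scale0r add0r addr0 => /eqP.
by rewrite scaler_eq0 (negPf xi_neq0) orbF => /eqP.
Qed.

Lemma adapted_unit : F \in unitmx.
Proof.
rewrite -row_free_unit -kermx_eq0; apply/eqP/row_matrixP => i; rewrite row0.
have : row i (kermx F) *m F = 0 by apply/sub_kermxP; exact: row_sub.
move: (row _ _) => r rF.
have := mul_triple_mx (\matrix_(i < 3) r) T xi phiT; rewrite -/F.
have -> : (\matrix_(i < 3) r) *m F = triple_mx 0 0 0.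
  by apply/row_matrixP => k; rewrite row_mul !rowK rF; case: k => -[|[|[]]].
case/triple_mx_inj => /esym + _ _; rewrite !mxE => /adapted_free[r0 r1 r2].
by apply/rowP => k; rewrite [RHS]mxE; case: (ord3 k) => ->.
Qed.

(** If a = b = 0 then T is orthogonal to itself, to xi and to phi T, which
    form a basis; as g is nondegenerate this contradicts T <> 0. *)
Lemma adapted_disc_gt0 : 0 < a ^+ 4 + b ^+ 2.
Proof.
have a4_ge0 : 0 <= a ^+ 4 by rewrite (exprM a 2 2) sqr_ge0.
rewrite lt0r addr_ge0 ?sqr_ge0// andbT.
apply: contraNneq T_neq0 => /eqP; rewrite paddr_eq0 ?sqr_ge0//.
rewrite !expf_eq0/= => /andP[/eqP a0 /eqP b0].
have TGF : T *m G *m F^T = 0.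
  apply/rowP => k; transitivity (bil_app G T (row k F)).
    by rewrite /bil_app tr_row colE mulmxA -colE [RHS]mxE.
  rewrite rowK mxE; case: (ord3 k) => -> /=; first exact: TT.
    by rewrite Txi a0.
  by rewrite TphiT b0.
have uF : F^T \in unitmx by rewrite unitmx_tr adapted_unit.
have : T *m G = 0 by rewrite -[LHS](mulmxK uF) TGF mul0mx.
by move=> /(congr1 (mulmxr (invmx G))); rewrite /= mulmxK// mul0mx => /eqP.
Qed.

Local Notation comb x y z := (x *: xi + y *: T + z *: phiT).

Lemma bil_comb x y z x' y' z' :
  bil_app G (comb x y z) (comb x' y' z') = x * x' + z * z' * a ^+ 2
    + y' * (x * a + z * b) + y * (x' * a + z' * b).
Proof.
have [xiT xixi xiphi [phiT_T phixi phiphi]] := adapted_gram.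
rewrite !bilE TT Txi TphiT xiT xixi xiphi phiT_T phixi phiphi; ring.
Qed.

Lemma bil_T_comb x y z : bil_app G T (comb x y z) = x * a + z * b.
Proof. by rewrite !bilE TT Txi TphiT; ring. Qed.

Lemma frame_of_coefs be (N W : 'rV[R]_3) :
  W = comb (coef_alpha a b) be (coef_gamma a b) ->
  N = comb (coef_lambda a b be) (coef_mu a b be) (coef_nu a b be) ->
  [/\ triple_mx T N W \in unitmx,
      bil_app G T N = 1 /\ bil_app G W W = 1,
      bil_app G N N = 0, bil_app G N W = 0 & bil_app G T W = 0] /\
  same_orientation (triple_mx T N W) F.
Proof.
have [[]] := frame_coefsP adapted_disc_gt0 be.
set al := coef_alpha _ _; set ga := coef_gamma _ _; set la := coef_lambda _ _ _.
set mu := coef_mu _ _ _; set nu := coef_nu _ _ _.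
move=> TN TW WW NN NW D_gt0 WE NE.
pose P : 'M[R]_3 := \matrix_(i, j) nth 0 (nth [::]
  [:: [:: 1; 0; 0]; [:: mu; la; nu]; [:: be; al; ga]] i) j.
have PF : triple_mx T N W = P *m F.
  rewrite mul_triple_mx !mxE /= NE WE scale1r !scale0r !addr0.
  by rewrite ![_ *: T + _]addrC.
have detP : \det P = la * ga - nu * al by rewrite det_mx33 !mxE /=; ring.
split; last by exists P => //; rewrite detP.
split.
- rewrite PF unitmx_mul adapted_unit andbT unitmxE detP unitfE.
  by rewrite gt_eqF.
- rewrite NE WE bil_comb bil_T_comb TN TW; split=> //.
  by rewrite !mulr0 !addr0 -!expr2.
- by rewrite NE bil_comb TN -!expr2; rewrite -[RHS]NN; ring.
- by rewrite NE WE bil_comb TN TW -[RHS]NW; ring.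
- by rewrite WE bil_T_comb.
Qed.

(** The formula for beta inverts the products g(W,xi) = alpha + beta a and
    g(W,phi T) = beta b + gamma a^2: with the weights a^3 and b, the terms in
    alpha and gamma add up to a^2 g(T,W) = 0. *)
Lemma coefs_of_frame (N W : 'rV[R]_3)
    (be := (a ^+ 3 * bil_app G W xi + b * bil_app G W phiT)
           / (a ^+ 4 + b ^+ 2)) :
  bil_app G T N = 1 -> bil_app G W W = 1 -> bil_app G N N = 0 ->
  bil_app G N W = 0 -> bil_app G T W = 0 ->
  same_orientation (triple_mx T N W) F ->
  W = comb (coef_alpha a b) be (coef_gamma a b) /\
  N = comb (coef_lambda a b be) (coef_mu a b be) (coef_nu a b be).
Proof.
move=> TN WW NN NW TW [P]; rewrite mul_triple_mx det_mx33.
set mu := P 1 0; set la := P 1 1; set nu := P 1 2.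
set be' := P 2 0; set al := P 2 1; set ga := P 2 2.
case/triple_mx_inj => TE NE WE.
have [] : [/\ P 0 0 - 1 = 0, P 0 1 = 0 & P 0 2 = 0].
  apply: adapted_free; rewrite scalerBl scale1r -addrA addrAC addrA.
  by rewrite -TE subrr.
move=> /subr0_eq -> -> ->; rewrite mul1r !mul0r subr0 addr0 => D_gt0.
have NE' : N = comb la mu nu by rewrite NE [_ *: T + _]addrC.
have WE' : W = comb al be' ga by rewrite WE [_ *: T + _]addrC.
move: TN WW NN NW TW; rewrite NE' WE' !bil_comb !bil_T_comb.
move=> TN WW NN NW TW.
have [alE gaE laE muE nuE] : [/\ al = coef_alpha a b, ga = coef_gamma a b,
    la = coef_lambda a b be', mu = coef_mu a b be' & nu = coef_nu a b be'].
  apply: frame_coefs_unique => //; first exact: adapted_disc_gt0.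
  - by rewrite -[RHS]WW; ring.
  - by rewrite -[RHS]NN; ring.
have -> : be = be'; last by rewrite -alE -gaE -laE -muE -nuE.
apply: (canLR (mulfK (lt0r_neq0 adapted_disc_gt0))).
have [xiT xixi xiphi [phiT_T phixi phiphi]] := adapted_gram.
rewrite WE' !bilE Txi TphiT xixi xiphi phixi phiphi.
have := congr1 ( *%R (a ^+ 2)) TW; lra.
Qed.

(** A stands for nabla_T T, whose products with N and W are h and k. *)
Lemma frenet_coefs_of_projections (N W A : 'rV[R]_3) al be ga la mu nu h k x y :
  W = comb al be ga -> N = comb la mu nu ->
  bil_app G T N = 1 -> bil_app G W W = 1 ->
  bil_app G N W = 0 -> bil_app G T W = 0 ->
  A = h *: T + k *: W ->
  bil_app G A T = 0 -> bil_app G A xi = - x -> 2 * bil_app G A phiT = y ->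
  h = - la * x + nu / 2 * y /\ k = - al * x + ga / 2 * y.
Proof.
move=> WE NE TN WW NW TW AE AT Axi Aphi.
have AN : bil_app G A N = h by rewrite AE !bilE TN (bilC W)// NW; ring.
have AW : bil_app G A W = k by rewrite AE !bilE TW WW; ring.
split; first by rewrite -AN NE !bilE AT Axi -Aphi; field.
by rewrite -AW {1}WE !bilE AT Axi -Aphi; field.
Qed.

End NullVector.
End PointwiseAlgebra.

(** * Calculus along a curve *)

Section Along.
Context {R : realType} {n : nat} {M : smooth_manifold R n}.
Variables (I : set R) (C : R -> M).
Hypothesis smoothC : smooth_curve I C.
Implicit Types (c d : chart M).

Definition chart_times c : set R := I `&` C @^-1` dom c.

Lemma open_chart_times c : open (chart_times c).
Proof.
have [oI _ cC _] := smoothC; rewrite openE => t [It Ct].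
apply: filterI; first exact: open_nbhs_nbhs.
by apply: (cC t It); exact: open_nbhs_nbhs (conj (dom_open c) Ct).
Qed.

Lemma near_chart_times c t :
  chart_times c t -> \forall s \near t, chart_times c s.
Proof.
by move=> Jt; apply: open_nbhs_nbhs; split=> //; exact: open_chart_times.
Qed.

(** Along the curve, f is its expression in the chart composed with the
    coordinates of the curve. *)
Lemma Ck_along (W : normedModType R) k c (f : M -> W) :
  smooth_in_chart c f -> Ck k (chart_times c) (f \o C).
Proof.
move=> sf; have [_ _ _ /(_ c k) sC] := smoothC.
have oJ := @open_chart_times c.
apply: Ck_eq_on oJ _ (Ck_comp oJ _ (sf k) sC) => t [_ Ct].
  by rewrite /= coordK.
by exists (C t).
Qed.

Lemma Ck_velocity k c : Ck k (chart_times c) (velocity C c).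
Proof.
have [_ _ _ /(_ c k.+1)[_ /(_ 1)]] := smoothC.
by congr Ck; apply/funext => t; rewrite /velocity derive1E.
Qed.

(** Differentiability is asked at one point only, so that this applies also to
    the coordinates of another chart, as in [velocity_law]. *)
Lemma derive1_along (W : normedModType R) c (f : M -> W) t :
  chart_times c t -> differentiable (f \o param c) (Defs.coord c (C t)) ->
  derive1 (f \o C) t = chart_derive c f (C t) (velocity C c t).
Proof.
move=> Jt df; have [_ _ _ /(_ c 1%N)[/(_ t Jt) dC _]] := smoothC.
rewrite /chart_derive /velocity !derive1E -derive_comp//.
apply: near_eq_derive; apply: filterS (near_chart_times Jt) => s [_ Cs] /=.
by rewrite coordK.
Qed.

Lemma velocity_law c d t : chart_times c t -> chart_times d t ->
  velocity C d t = velocity C c t *m transition_mx c d (C t).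
Proof.
move=> Jc Jd; have Cct : (Defs.coord c @` (dom c `&` dom d)) (Defs.coord c (C t)).
  by exists (C t) => //; split; [have [] := Jc|have [] := Jd].
have [/(_ _ Cct) dcd _] := @transition_smooth _ _ M c d 1%N.
by rewrite {1}/velocity (derive1_along Jc)// /chart_derive deriveEjacobian.
Qed.

End Along.

Section MetricConnection.
Context {R : realType} {n : nat} {M : smooth_manifold R n}.
Variables (I : set R) (C : R -> M) (g : bilinear_field M) (D : connection M).
Hypothesis smoothC : smooth_curve I C.

Lemma bil_app_chart c d p (u v : 'rV[R]_n) : dom c p -> dom d p ->
  bil_app (g d p) (u *m transition_mx c d p) (v *m transition_mx c d p) =
  bil_app (g c p) u v.
Proof.
by move=> pc pd; rewrite /bil_app (bil_law g pc pd) trmx_mul !mulmxA.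
Qed.

Lemma smooth_differentiable (W : normedModType R) c (f : M -> W) p :
  smooth_in_chart c f -> dom c p -> differentiable (f \o param c) (Defs.coord c p).
Proof. by move=> /(_ 1%N)[df _] pc; apply: df; exists p. Qed.

Lemma smooth_differentiable_along (W : normedModType R) c (f : M -> W) t :
  smooth_in_chart c f -> chart_times I C c t -> differentiable (f \o C) t.
Proof. by move=> /(Ck_along smoothC 1)[df _]; apply: df. Qed.

(** Since nabla g = 0, the derivative of the matrix G of g along the curve is
    om *m G + G *m om^T, with om the connection matrix; the Leibniz rule for
    X *m G *m Y^T then regroups into covariant derivatives. *)
Lemma derive1_bil_along c t (X Y : chart M -> R -> 'rV[R]_n) :
  nabla_bil D g c (C t) (velocity C c t) = 0 -> chart_times I C c t ->
  differentiable (X c) t -> differentiable (Y c) t ->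
  derive1 (fun s => bil_app (g c (C s)) (X c s) (Y c s)) t =
  bil_app (g c (C t)) (nabla_along D C X c t) (Y c t)
  + bil_app (g c (C t)) (X c t) (nabla_along D C Y c t).
Proof.
move=> g0 Jt dX dY; rewrite /nabla_along; set om := D c (C t) _.
have dg : differentiable (g c \o C) t.
  exact: smooth_differentiable_along (bil_smooth _ _) Jt.
have g'E : 'D_1 (g c \o C) t = om *m g c (C t) + g c (C t) *m om^T.
  rewrite -derive1E (derive1_along smoothC Jt).
    by apply/eqP; rewrite -subr_eq0 opprD addrA -[X in _ == X]g0.
  by apply: smooth_differentiable => //; [exact: bil_smooth|have [] := Jt].
have [dXg XgE] := derive_mulmx (1 : R) dX dg.
have [dYT YTE] := derive_trmx (1 : R) dY.
have [dXgY XgYE] := derive_mulmx (1 : R) dXg dYT.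
rewrite derive1E /bil_app.
transitivity (('D_1 (fun y => X c y *m (g c \o C) y *m (Y c y)^T) t) 0 0).
  by rewrite derive_mx ?mxE//; exact: diff_derivable.
rewrite XgYE XgE YTE g'E /= !derive1E [(_ + _)^T]linearD/= trmx_mul.
by rewrite !(mulmxDl, mulmxDr) !mulmxA ![fun_of_matrix (_ + _) _ _]mxE; ring.
Qed.

Lemma nabla_along_vf (xi : vector_field M) c t : chart_times I C c t ->
  nabla_along D C (fun c => xi c \o C) c t =
  nabla_vf D xi c (C t) (velocity C c t).
Proof.
move=> Jt; rewrite /nabla_along /nabla_vf (derive1_along smoothC Jt)//.
by apply: smooth_differentiable => //; [exact: vf_smooth|have [] := Jt].
Qed.

Lemma nabla_along_endo (phi : endo_field M) (X : chart M -> R -> 'rV[R]_n) c t :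
  chart_times I C c t -> differentiable (X c) t ->
  nabla_along D C (fun c s => X c s *m phi c (C s)) c t =
  nabla_along D C X c t *m phi c (C t)
  + X c t *m nabla_endo D phi c (C t) (velocity C c t).
Proof.
move=> Jt dX; have dphi : differentiable (phi c \o C) t.
  exact: smooth_differentiable_along (endo_smooth _ _) Jt.
have [_ E] := derive_mulmx (1 : R) dX dphi.
rewrite /nabla_along /nabla_endo derive1E E -!derive1E (derive1_along smoothC Jt).
  rewrite mulmxDl mulmxBr mulmxDr !mulmxA /= -!addrA; congr (_ + _).
  by rewrite [RHS]addrC -!addrA addNr addr0.
by apply: smooth_differentiable => //; [exact: endo_smooth|have [] := Jt].
Qed.

End MetricConnection.

(** * Slant null curves *)

Section SlantNullCurve.
Context {R : realType} {M : smooth_manifold R 3}.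
Context {phi : endo_field M} {xi : vector_field M} {eta : one_form M}.
Context {g : bilinear_field M} {I : set R} {C : R -> M} {a : R} {b : R -> R}.
Hypothesis hM : almost_contact_B_metric phi xi eta g.
Hypothesis hC : null_curve g I C.
Hypothesis ha : slant xi eta g I C a.
Hypothesis hb : forall t c, I t -> dom c (C t) ->
  b t = bil_app (g c (C t)) (velocity C c t) (velocity C c t *m phi c (C t)).

Local Notation J c := (chart_times I C c).

Let smoothC : smooth_curve I C. Proof. exact: hC.1. Qed.
Let oJ c : open (J c). Proof. exact: open_chart_times. Qed.

Definition frame_beta (W : chart M -> R -> 'rV[R]_3) c t : R :=
  (a ^+ 3 * bil_app (g c (C t)) (W c t) (xi c (C t))
   + b t * bil_app (g c (C t)) (W c t) (velocity C c t *m phi c (C t)))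
  / (a ^+ 4 + b t ^+ 2).

Lemma slant_disc_gt0 c t : J c t -> 0 < a ^+ 4 + b t ^+ 2.
Proof.
move=> [It Ct]; have [pr /(_ _ _ Ct)[h1 h2 h3]] := hM.
have [_ uG] := pr _ _ Ct; have [T0 TT] := hC.2 _ _ It Ct.
have [Txi _] := ha It Ct.
exact (adapted_disc_gt0 uG h1 h2 h3 T0 TT Txi (esym (hb It Ct))).
Qed.

Lemma phi_velocity_law c d t : J c t -> J d t ->
  velocity C d t *m phi d (C t) =
  velocity C c t *m phi c (C t) *m transition_mx c d (C t).
Proof.
move=> Jc Jd; rewrite (velocity_law smoothC Jc Jd) -!mulmxA.
by rewrite -(endo_law phi (proj2 Jc) (proj2 Jd)).
Qed.

Lemma Ck_bil_along k c (X Y : R -> 'rV[R]_3) : Ck k (J c) X -> Ck k (J c) Y ->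
  Ck k (J c) (fun s => bil_app (g c (C s)) (X s) (Y s)).
Proof.
move=> sX sY; apply: (@Ck_coord _ _ _ _ _ _
  (fun s => X s *m g c (C s) *m (Y s)^T) 0 0 (@oJ c)); apply: (Ck_mulmx (@oJ c)).
  apply: (Ck_mulmx (@oJ c)) => //; exact: Ck_along (bil_smooth g c).
exact: Ck_trmx.
Qed.

Lemma Ck_phi_velocity k c :
  Ck k (J c) (fun s => velocity C c s *m phi c (C s)).
Proof.
apply: (Ck_mulmx (@oJ c)); first exact: Ck_velocity.
exact: Ck_along (endo_smooth phi c).
Qed.

Lemma Ck_b k c : Ck k (J c) b.
Proof.
apply: Ck_eq_on (@oJ c) _ (Ck_bil_along (Ck_velocity smoothC k c) (Ck_phi_velocity k c)).
by move=> t [It Ct]; rewrite -hb.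
Qed.

Lemma Ck_disc k c : Ck k (J c) (fun t => a ^+ 4 + b t ^+ 2).
Proof.
by apply: (CkD (@oJ c)); [exact: Ck_cst|apply: (CkM (@oJ c)); exact: Ck_b].
Qed.

Lemma frame_beta_chart I' W c d t : field_along I' C W -> I' t -> J c t -> J d t ->
  frame_beta W c t = frame_beta W d t.
Proof.
move=> [Wlaw _] I't Jc Jd; have [[It pc] [_ pd]] := (Jc, Jd).
rewrite /frame_beta (Wlaw t c d)// (vf_law xi pc pd) (phi_velocity_law Jc Jd).
by rewrite !bil_app_chart.
Qed.

Lemma Ck_frame_beta k W c : field_along I C W -> Ck k (J c) (frame_beta W c).
Proof.
move=> [_ sW]; have oJc := @oJ c; apply: (CkM oJc); last first.
  apply: (Ck_inv oJc) (Ck_disc k c) => t Jt.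
  by rewrite gt_eqF// (slant_disc_gt0 Jt).
apply: (CkD oJc); apply: (CkM oJc).
- exact: Ck_cst.
- by apply: Ck_bil_along; [exact: sW|exact: Ck_along (vf_smooth xi c)].
- exact: Ck_b.
- by apply: Ck_bil_along; [exact: sW|exact: Ck_phi_velocity].
Qed.

(** The function beta reads [frame_beta] in some chart around each point;
    near any given time it coincides with the reading in one fixed chart, which
    is smooth. *)
Lemma frame_formulas_beta N W :
  general_frenet_frame g I C N W -> positively_oriented phi xi I C N W ->
  exists2 beta, smooth_on I beta & frame_formulas phi xi I C a b beta N W.
Proof.
move=> [_ along_W fr] orient.
have [ch chP] : exists ch : M -> chart M, forall p, dom (ch p) p.
  by exists (fun p => sval (cid (dom_cover p))) => p; case: cid.
exists (fun t => frame_beta W (ch (C t)) t) => [k|t c It Ct].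
  apply: Ck_local => t It; exists (J (ch (C t))); first by split=> //; exact: chP.
  have := @Ck_frame_beta k W (ch (C t)) along_W.
  apply: Ck_eq_on (@oJ _) _ => s [Is Cs].
  by apply: (frame_beta_chart along_W Is) => //; split=> //; exact: chP.
have Jt : J c t by [].
have -> : frame_beta W (ch (C t)) t = frame_beta W c t.
  by apply: (frame_beta_chart along_W It _ Jt); split=> //; exact: chP.
have [pr /(_ _ _ Ct)[h1 h2 h3]] := hM.
have [sG uG] := pr _ _ Ct; have [T0 TT] := hC.2 _ _ It Ct.
have [Txi _] := ha It Ct.
have [_ [TN WW] NN NW TW] := fr _ _ It Ct.
exact (coefs_of_frame sG uG h1 h2 h3 T0 TT Txi (esym (hb It Ct))
  TN WW NN NW TW (orient _ _ It Ct)).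
Qed.

(** These are the derivatives along the curve of g(T,T) = 0, of g(T,xi) = a and
    of g(T,phi T) = b. *)
Lemma velocity_projections D c t (A := nabla_along D C (velocity C) c t)
    (T := velocity C c t) :
  levi_civita g D -> J c t ->
  [/\ bil_app (g c (C t)) A T = 0,
      bil_app (g c (C t)) A (xi c (C t)) =
        - bil_app (g c (C t)) T (nabla_vf D xi c (C t) T) &
      2 * bil_app (g c (C t)) A (T *m phi c (C t)) =
        derive1 b t - tensor_F g D phi c (C t) T T T].
Proof.
move=> lc Jt; have [It Ct] := Jt; have [_ /(_ T) g0] := lc _ _ Ct.
have [pr /(_ _ _ Ct)[h1 h2 h3]] := hM; have [sG uG] := pr _ _ Ct.
have dT : differentiable (velocity C c) t.
  by have [dT _] := Ck_velocity smoothC 1 c; exact: dT.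
have near_derive1 (f h : R -> R) : (forall s, J c s -> f s = h s) ->
    derive1 f t = derive1 h t.
  move=> fh; rewrite !derive1E; apply: near_eq_derive.
  by apply: filterS (near_chart_times smoothC Jt) => s; exact: fh.
have E := derive1_bil_along smoothC g0 Jt.
split.
- have := E (velocity C) (velocity C) dT dT; rewrite -/A -/T (bilC T)//.
  rewrite (near_derive1 _ (fun=> 0)) => [|s [Is Cs]]; last first.
    by have [] := hC.2 _ _ Is Cs.
  rewrite derive1_cst => /esym/eqP; rewrite -mulr2n mulrn_eq0/=.
  by move=> /eqP.
- have dxi : differentiable (xi c \o C) t.
    exact: smooth_differentiable_along (vf_smooth _ _) Jt.
  have := E (velocity C) (fun c => xi c \o C) dT dxi; rewrite -/A -/T.
  rewrite (near_derive1 _ (fun=> a)) => [|s [Is Cs]]; last first.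
    by have [] := ha Is Cs.
  rewrite derive1_cst (nabla_along_vf D smoothC)// -/T => /esym/eqP.
  by rewrite addr_eq0 => /eqP.
- have dphiT : differentiable (fun s => velocity C c s *m phi c (C s)) t.
    by have [dphiT _] := Ck_phi_velocity 1 c; exact: dphiT.
  have := E (velocity C) (fun c s => velocity C c s *m phi c (C s)) dT dphiT.
  rewrite -/A -/T (near_derive1 _ b) => [|s [Is Cs]]; last by rewrite -hb.
  rewrite (nabla_along_endo D smoothC)// -/A -/T bilDr => ->.
  (* g(T, phi A) = g(A, phi T), so that this product is counted twice *)
  rewrite (bilC T (A *m _))// (bil_phi h1 h2 h3) /tensor_F (bilC (T *m _) T)//.
  by ring.
Qed.

Lemma frenet_coefs_beta D N W beta h k1 k2 t c (T := velocity C c t)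
    (x := bil_app (g c (C t)) T (nabla_vf D xi c (C t) T))
    (y := derive1 b t - tensor_F g D phi c (C t) T T T) :
  levi_civita g D -> general_frenet_frame g I C N W ->
  frame_formulas phi xi I C a b beta N W ->
  general_frenet_equations D I C N W h k1 k2 -> J c t ->
  h t = - coef_lambda a (b t) (beta t) * x + coef_nu a (b t) (beta t) / 2 * y /\
  k1 t = - coef_alpha a (b t) * x + coef_gamma a (b t) / 2 * y.
Proof.
move=> lc [_ _ fr] ff [_ _ _ fe] Jt; have [It Ct] := Jt.
have [AT Axi Aphi] := velocity_projections lc Jt.
have [_ [TN WW] _ NW TW] := fr _ _ It Ct.
have [WE NE] := ff _ _ It Ct; have [AE _ _] := fe _ _ It Ct.
have [sG _] := hM.1 _ _ Ct.
exact (frenet_coefs_of_projections sG WE NE TN WW NW TW AE AT Axi Aphi).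
Qed.

(** The coefficients are functions of time alone, so the combination inherits
    the transformation law of xi, T and phi T. *)
Lemma field_along_comb (al be ga : R -> R) (V : chart M -> R -> 'rV[R]_3) :
  (forall k c, Ck k (J c) al) -> (forall k c, Ck k (J c) be) ->
  (forall k c, Ck k (J c) ga) ->
  (forall t c, I t -> dom c (C t) -> V c t = al t *: xi c (C t)
     + be t *: velocity C c t + ga t *: (velocity C c t *m phi c (C t))) ->
  field_along I C V.
Proof.
move=> sal sbe sga VE; split=> [t c d It Ct Dt|c k].
  have [Jc Jd] : J c t /\ J d t by [].
  rewrite (VE t c)// (VE t d)// (phi_velocity_law Jc Jd).
  rewrite (velocity_law smoothC Jc Jd) (vf_law xi Ct Dt).
  by rewrite !mulmxDl !scalemxAl.
have oJc := @oJ c.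
apply: (Ck_eq_on oJc) => [t [It Ct]|]; first by rewrite VE.
apply: (CkD oJc); first apply: (CkD oJc).
- apply: (Ck_scale oJc) => //; exact: Ck_along (vf_smooth xi c).
- by apply: (Ck_scale oJc) => //; exact: Ck_velocity.
- by apply: (Ck_scale oJc) => //; exact: Ck_phi_velocity.
Qed.

Lemma Ck_coefs (beta : R -> R) k c : Ck k (J c) beta ->
  [/\ Ck k (J c) (fun t => coef_alpha a (b t)),
      Ck k (J c) (fun t => coef_gamma a (b t)),
      Ck k (J c) (fun t => coef_lambda a (b t) (beta t)),
      Ck k (J c) (fun t => coef_mu a (b t) (beta t)) &
      Ck k (J c) (fun t => coef_nu a (b t) (beta t))].
Proof.
move=> sbeta; have oJc := @oJ c; have sb := Ck_b k c; have sS := Ck_disc k c.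
have S_gt0 t := @slant_disc_gt0 c t.
have ss := Ck_sqrt oJc S_gt0 sS.
have sVs : Ck k (J c) (fun t => (Num.sqrt (a ^+ 4 + b t ^+ 2))^-1).
  by apply: (Ck_inv oJc) ss => t Jt; rewrite gt_eqF// sqrtr_gt0 S_gt0.
have sVS : Ck k (J c) (fun t => (a ^+ 4 + b t ^+ 2)^-1).
  by apply: (Ck_inv oJc) sS => t Jt; rewrite gt_eqF// S_gt0.
have cst (x : R) : Ck k (J c) (fun=> x) by exact: Ck_cst.
split.
- exact: CkN oJc (CkM oJc sb sVs).
- exact: CkM oJc (cst a) sVs.
- exact: CkM oJc (CkD oJc (cst (a ^+ 3)) (CkM oJc (CkM oJc sbeta sb) ss)) sVS.
- apply: (CkN oJc); apply: (CkM oJc).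
    exact: CkD oJc (cst (a ^+ 2)) (CkM oJc (CkM oJc sbeta sbeta) sS).
  apply: (Ck_inv oJc) (CkM oJc (cst 2) sS) => t Jt.
  by rewrite mulf_neq0// gt_eqF// S_gt0.
- have sbas := CkM oJc (CkM oJc sbeta (cst a)) ss.
  exact: CkM oJc (CkD oJc sb (CkN oJc sbas)) sVS.
Qed.

Lemma general_frenet_frame_of_beta (beta : R -> R) N W :
  smooth_on I beta -> frame_formulas phi xi I C a b beta N W ->
  general_frenet_frame g I C N W /\ positively_oriented phi xi I C N W.
Proof.
move=> sbeta ff; have Jbeta k c : Ck k (J c) beta.
  by apply: Ck_sub (sbeta k) => t [].
have coefs k c := Ck_coefs (Jbeta k c).
have fr t c (It : I t) (Ct : dom c (C t)) : _ /\ _ :=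
  let: conj pr H := hM in let: And3 h1 h2 h3 := H _ _ Ct in
  let: conj sG uG := pr _ _ Ct in let: conj T0 TT := hC.2 _ _ It Ct in
  let: conj Txi _ := ha It Ct in let: conj WE NE := ff _ _ It Ct in
  frame_of_coefs sG uG h1 h2 h3 T0 TT Txi (esym (hb It Ct)) WE NE.
split; last by move=> t c It Ct; have [] := fr t c It Ct.
split; last by move=> t c It Ct; have [] := fr t c It Ct.
- apply: (@field_along_comb (fun t => coef_lambda a (b t) (beta t))
    (fun t => coef_mu a (b t) (beta t)) (fun t => coef_nu a (b t) (beta t))).
  + by move=> k c; have [] := coefs k c.
  + by move=> k c; have [] := coefs k c.
  + by move=> k c; have [] := coefs k c.
  + by move=> t c It Ct; have [] := ff t c It Ct.
- apply: (@field_along_comb (fun t => coef_alpha a (b t)) beta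
    (fun t => coef_gamma a (b t))) => //.
  + by move=> k c; have [] := coefs k c.
  + by move=> k c; have [] := coefs k c.
  + by move=> t c It Ct; have [] := ff t c It Ct.
Qed.

End SlantNullCurve.

Theorem proposition3p2 (R : realType) (M : smooth_manifold R 3)
    (phi : endo_field M) (xi : vector_field M) (eta : one_form M)
    (g : bilinear_field M) (D : connection M)
    (I : set R) (C : R -> M) (a : R) (b : R -> R)
    (hM : almost_contact_B_metric phi xi eta g)
    (hD : levi_civita g D)
    (hC : null_curve g I C)
    (ha : slant xi eta g I C a)
    (hb : forall t c, I t -> dom c (C t) ->
       b t = bil_app (g c (C t)) (velocity C c t)
               (velocity C c t *m phi c (C t)))
    (N W : chart M -> R -> 'rV[R]_3) :
  (general_frenet_frame g I C N W /\ positively_oriented phi xi I C N W ->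
   exists beta : R -> R,
     [/\ smooth_on I beta,
         frame_formulas phi xi I C a b beta N W &
         forall h k1 k2 : R -> R,
           general_frenet_equations D I C N W h k1 k2 ->
           forall t c, I t -> dom c (C t) ->
             let T := velocity C c t in
             let gTnablaxi :=
               bil_app (g c (C t)) T (nabla_vf D xi c (C t) T) in
             let bF := derive1 b t - tensor_F g D phi c (C t) T T T in
             h t = - coef_lambda a (b t) (beta t) * gTnablaxi
                   + coef_nu a (b t) (beta t) / 2 * bF /\
             k1 t = - coef_alpha a (b t) * gTnablaxi
                    + coef_gamma a (b t) / 2 * bF]) /\
  (forall beta : R -> R,
     smooth_on I beta -> frame_formulas phi xi I C a b beta N W ->
     general_frenet_frame g I C N W /\ positively_oriented phi xi I C N W).
Proof.
split=> [[fr orient]|beta sbeta ff].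
  have [beta sbeta ff] := frame_formulas_beta hM hC ha hb fr orient.
  exists beta; split=> // h k1 k2 fe t c It Ct.
  exact (frenet_coefs_beta hM hC ha hb hD fr ff fe (conj It Ct)).
exact (general_frenet_frame_of_beta hM hC ha hb sbeta ff).
Qed.
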